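(* Let $G^{\varphi}=(G,U(\mathbb{Q}),\varphi)$ be a connected $U(\mathbb{Q})$-gain graph of order $n$ with maximum degree $\Delta\geq 2$. Then $r(G^{\varphi})=\frac{n-2}{\Delta-1}$ if and only if one of the following holds: $G^{\varphi}$ is a $U(\mathbb{Q})$-gain cycle which is of Type 1; or $G^{\varphi}=K^{\varphi}_{\frac{n}{2},\frac{n}{2}}$ (that is, the underlying graph is the complete bipartite graph $K_{\frac n2,\frac n2}$) and each 4-cycle $C^{\varphi}_{4}$ in $G^{\varphi}$ is of Type 1.
   Context: $\mathbb{Q}$ denotes the skew field of real quaternions $q=x_0+x_1i+x_2j+x_3k$ ($x_0,\dots,x_3\in\mathbb{R}$), with conjugate $\bar q=x_0-x_1i-x_2j-x_3k$ and modulus $|q|=\sqrt{q\bar q}$; $U(\mathbb{Q})=\{q\in\mathbb{Q}:|q|=1\}$ is the multiplicative group of unit quaternions. A $U(\mathbb{Q})$-gain graph (quaternion unit gain graph) $G^{\varphi}=(G,U(\mathbb{Q}),\varphi)$ consists of a finite simple graph $G$ with vertices $v_1,\dots,v_n$ ($n\ge 1$ is the order) and a gain function $\varphi$ assigning to each oriented edge $e_{ij}$ (from $v_i$ to $v_j$, where $v_iv_j\in E(G)$; both orientations $e_{ij}$ and $e_{ji}$ of each edge are considered) an element $\varphi(e_{ij})=\varphi_{v_iv_j}\in U(\mathbb{Q})$ such that $\varphi(e_{ij})=\varphi(e_{ji})^{-1}=\overline{\varphi(e_{ji})}$. Its adjacency matrix $A(G^{\varphi})$ is the Hermitian $n\times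 n$ quaternion matrix with $(i,j)$ entry $\varphi(e_{ij})$ if $v_i$ and $v_j$ are adjacent and $0$ otherwise. The rank $r(G^{\varphi})$ is the row left rank of $A(G^{\varphi})$, i.e. the maximum number of rows of $A(G^{\varphi})$ that are left linearly independent (with respect to combinations $\sum_i q_i\alpha_i$ of rows $\alpha_i$ with quaternion coefficients $q_i$ multiplying on the left). Connectedness and the maximum degree $\Delta$ of $G^{\varphi}$ are those of the underlying graph $G$. A $U(\mathbb{Q})$-gain cycle $C_m^{\varphi}$ ($m\ge 3$) is a $U(\mathbb{Q})$-gain graph whose underlying graph is a cycle with consecutive vertices $u_1,u_2,\dots,u_m$; put $\varphi(C_m^{\varphi})=\varphi_{u_1u_2}\varphi_{u_2u_3}\cdots\varphi_{u_{m-1}u_m}\varphi_{u_mu_1}$. It is of Type 1 if $m$ is even and $\varphi(C_m^{\varphi})=(-1)^{m/2}$ (this does not depend on the starting vertex or the direction). In particular a 4-cycle is of Type 1 if and only if $\varphi(C_4^{\varphi})=1$. *)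

(* Defs.v *)
From HB Require Import structures.
From mathcomp Require Import all_boot all_order all_algebra.
From mathcomp Require Import boolp reals ring.

Set Implicit Arguments.
Unset Strict Implicit.
Unset Printing Implicit Defensive.

Import Order.TTheory GRing.Theory Num.Theory.
Local Open Scope ring_scope.

Record quat (R : realType) : Type :=
  Quat { q_re : R; q_i : R; q_j : R; q_k : R }.

Section Quaternions.
Variable R : realType.
Implicit Types p q r : quat R.

Definition quat_tuple q : R * R * R * R := (q_re q, q_i q, q_j q, q_k q).
Definition tuple_quat (t : R * R * R * R) : quat R :=
  let: (a, b, c, d) := t in Quat a b c d.

Lemma quat_tupleK : cancel quat_tuple tuple_quat.
Proof. by case. Qed.

HB.instance Definition _ := Choice.copy (quat R) (can_type quat_tupleK).

Definition addq p q :=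
  Quat (q_re p + q_re q) (q_i p + q_i q) (q_j p + q_j q) (q_k p + q_k q).
Definition oppq p := Quat (- q_re p) (- q_i p) (- q_j p) (- q_k p).

Definition mulq p q :=
  let: Quat a b c d := p in
  let: Quat a' b' c' d' := q in
  Quat (a * a' - b * b' - c * c' - d * d')
       (a * b' + b * a' + c * d' - d * c')
       (a * c' - b * d' + c * a' + d * b')
       (a * d' + b * c' - c * b' + d * a').

Lemma addqA : associative addq.
Proof. by case=> a b c d [? ? ? ?] [? ? ? ?]; rewrite /addq /= !addrA. Qed.
Lemma addqC : commutative addq.
Proof.
by case=> a b c d [a' b' c' d']; rewrite /addq /=; congr Quat; rewrite addrC.
Qed.
Lemma add0q : left_id (Quat 0 0 0 0) addq.
Proof. by case=> a b c d; rewrite /addq /= !add0r. Qed.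
Lemma addNq : left_inverse (Quat 0 0 0 0) oppq addq.
Proof. by case=> a b c d; rewrite /addq /= !addNr. Qed.
Lemma mulqA : associative mulq.
Proof.
by case=> a b c d [a' b' c' d'] [a'' b'' c'' d'']; rewrite /mulq; congr Quat; ring.
Qed.
Lemma mul1q : left_id (Quat 1 0 0 0) mulq.
Proof. by case=> a b c d; rewrite /mulq; congr Quat; ring. Qed.
Lemma mulq1 : right_id (Quat 1 0 0 0) mulq.
Proof. by case=> a b c d; rewrite /mulq; congr Quat; ring. Qed.
Lemma mulqDl : left_distributive mulq addq.
Proof.
by case=> a b c d [a' b' c' d'] [a'' b'' c'' d'']; rewrite /mulq /addq /=;
   congr Quat; ring.
Qed.
Lemma mulqDr : right_distributive mulq addq.
Proof.
by case=> a b c d [a' b' c' d'] [a'' b'' c'' d'']; rewrite /mulq /addq /=;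
   congr Quat; ring.
Qed.
Lemma oneq_neq0 : (Quat 1 0 0 0 : quat R) != Quat 0 0 0 0.
Proof. by apply/eqP=> -[] /eqP; rewrite oner_eq0. Qed.

HB.instance Definition _ :=
  GRing.isZmodule.Build (quat R) addqA addqC add0q addNq.
HB.instance Definition _ := GRing.Zmodule_isNzRing.Build (quat R)
  mulqA mul1q mulq1 mulqDl mulqDr oneq_neq0.

Definition conjq q := Quat (q_re q) (- q_i q) (- q_j q) (- q_k q).

(* q * conjq q is a real number (mulq_conj), so [q_re] loses nothing here. *)
Definition normq q : R := Num.sqrt (q_re (q * conjq q)).

Definition sqrq q : R := q_re q ^+ 2 + q_i q ^+ 2 + q_j q ^+ 2 + q_k q ^+ 2.

Lemma mulq_conj q : q * conjq q = Quat (sqrq q) 0 0 0.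
Proof.
by case: q => a b c d; rewrite /GRing.mul /= /sqrq /=; congr Quat; ring.
Qed.

Lemma sqrq_eq0 q : (sqrq q == 0) = (q == 0).
Proof.
case: q => a b c d; rewrite /sqrq /=.
rewrite !paddr_eq0 ?addr_ge0 ?sqr_ge0 // !sqrf_eq0.
apply/idP/eqP => [/andP[/andP[/andP[/eqP-> /eqP->] /eqP->] /eqP->] // |].
by case=> -> -> -> ->; rewrite eqxx.
Qed.

Definition invq q :=
  let s := sqrq q in
  Quat (q_re q / s) (- q_i q / s) (- q_j q / s) (- q_k q / s).

Definition nonzeroq : pred (quat R) := fun q => q != 0.

Lemma mulVq : {in nonzeroq, left_inverse 1 invq *%R}.
Proof.
move=> q; rewrite unfold_in /nonzeroq -sqrq_eq0.
case: q => a b c d; rewrite /sqrq /= => s0.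
by rewrite /GRing.mul /= /sqrq /=; congr Quat; field.
Qed.

Lemma mulqV : {in nonzeroq, right_inverse 1 invq *%R}.
Proof.
move=> q; rewrite unfold_in /nonzeroq -sqrq_eq0.
case: q => a b c d; rewrite /sqrq /= => s0.
by rewrite /GRing.mul /= /sqrq /=; congr Quat; field.
Qed.

Lemma nonzeroqP p q : q * p = 1 /\ p * q = 1 -> nonzeroq p.
Proof.
case=> qp1 _; apply/eqP => p0; move: qp1; rewrite p0 mulr0 => /eqP.
by rewrite eq_sym oner_eq0.
Qed.

Lemma invq_out : {in [predC nonzeroq], invq =1 id}.
Proof.
move=> q; rewrite !unfold_in /= negbK => /eqP ->.
by rewrite /invq /= !oppr0 !mul0r.
Qed.

HB.instance Definition _ := GRing.NzRing_hasMulInverse.Build (quat R)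
  mulVq mulqV nonzeroqP invq_out.

(* On U(Q) the inverse is the conjugate, so that requiring one of
   phi_ij = phi_ji^-1 and phi_ij = conjq phi_ji amounts to requiring both. *)
Lemma normq1_inv q : normq q = 1 -> q^-1 = conjq q.
Proof.
rewrite /normq mulq_conj /= => nq.
have sq : sqrq q = 1.
  have s_ge0 : 0 <= sqrq q by rewrite /sqrq !addr_ge0 ?sqr_ge0.
  by rewrite -(sqr_sqrtr s_ge0) nq expr1n.
by rewrite /GRing.inv /= /invq sq !divr1.
Qed.

End Quaternions.

Section LeftRank.
Variables (K : nzRingType) (m n : nat).
Implicit Type A : 'M[K]_(m, n).

(* [*:] on matrices multiplies by scalars on the left. *)
Definition left_independent_rows A (S : {set 'I_m}) : Prop :=
  forall q : 'I_m -> K,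
    \sum_(i in S) q i *: row i A = 0 -> forall i, i \in S -> q i = 0.

Definition left_row_rank A : nat :=
  \max_(S : {set 'I_m} | `[< left_independent_rows A S >]) #|S|.

End LeftRank.

Record sgraph (n : nat) := SGraph {
  adj : rel 'I_n;
  adj_sym : symmetric adj;
  adj_irr : irreflexive adj }.

Section SimpleGraphs.
Variables (n : nat) (G : sgraph n).

Definition connected_graph : Prop := forall i j : 'I_n, connect (adj G) i j.

Definition degree (i : 'I_n) : nat := #|[set j | adj G i j]|.
Definition max_degree : nat := \max_(i < n) degree i.

Definition is_complete_bipartite (a b : nat) : Prop :=
  exists X : {set 'I_n}, [/\ #|X| = a, #|~: X| = b &
    forall i j, adj G i j = ((i \in X) != (j \in X))].

(* c = [:: u_1; ...; u_m] lists the consecutive vertices of a cycle contained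
   in G as a (not necessarily induced) subgraph. *)
Definition is_cycle_in (c : seq 'I_n) : Prop :=
  [/\ (3 <= size c)%N, uniq c & cycle (adj G) c].

(* G itself is the cycle u_1 u_2 ... u_m u_1. *)
Definition is_cycle_graph (c : seq 'I_n) : Prop :=
  [/\ is_cycle_in c, forall i, i \in c &
      forall i j, adj G i j = (j == next c i) || (i == next c j)].

End SimpleGraphs.

(* [gain] is only meaningful on adjacent pairs; its other values are
   unconstrained and never used. *)
Record gain_graph (R : realType) (n : nat) := GainGraph {
  ugraph :> sgraph n;
  gain : 'I_n -> 'I_n -> quat R;
  gain_norm : forall i j, adj ugraph i j -> normq (gain i j) = 1;
  gain_inv : forall i j, adj ugraph i j -> gain i j = (gain j i)^-1 }.

Section GainGraphs.
Variables (R : realType) (n : nat) (G : gain_graph R n).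

Definition adjacency : 'M[quat R]_n :=
  \matrix_(i, j) (if adj G i j then gain G i j else 0).

Definition gain_rank : nat := left_row_rank adjacency.

(* The ordered product phi_{u_1 u_2} * ... * phi_{u_m u_1}, taken from left to
   right along c. *)
Definition cycle_gain (c : seq 'I_n) : quat R :=
  \prod_(u <- c) gain G u (next c u).

Definition type1 (c : seq 'I_n) : Prop :=
  ~~ odd (size c) /\ cycle_gain c = (-1) ^+ (size c)./2.

End GainGraphs.

(* Main.v *)
(* A maximal nonsingular principal submatrix of the Hermitian matrix A(G) can be
   grown from any nonsingular one by adding, one at a time, vertices adjacent to
   the current set: as long as the Schur complement is not zero, connectedness
   yields a nonzero entry in the row of a vertex adjacent to the set.  This gives
   a connected set S of size r = r(G) which dominates G.  Counting the edges at
   S, which spans at least r - 1 edges, gives n - r <= r (Delta - 2) + 2, that is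
   r >= (n - 2) / (Delta - 1).  In case of equality nothing may be lost:
   S induces a tree, vertices outside S have a single neighbour in S, and the
   degrees on S are all Delta.  As S may be grown from any induced path with an
   even number of vertices (these are nonsingular), G is Delta-regular and a
   vertex outside such a path has at most one neighbour on it.  For a longest such
   path, the outer neighbours of its two ends are therefore completely joined.
   If it has two vertices, G is complete bipartite; otherwise moving the path by
   one step rules out Delta >= 3, and Delta = 2 leaves a cycle.  The gain
   conditions say exactly that the remaining rows lie in the span of those of
   S. *)

Require Import Defs.
From mathcomp Require Import all_boot all_order all_algebra.
From mathcomp Require Import boolp reals.
From mathcomp Require Import ring zify.

Import GRing.Theory Num.Theory.
Local Open Scope ring_scope.

Set Implicit Arguments.
Unset Strict Implicit.

(** * Linear algebra over the quaternions *)

Section QuaternionAlgebra.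
Variable R : realType.
Implicit Types p q : quat R.

Lemma quat_unit q : q != 0 -> q \is a GRing.unit.
Proof. by []. Qed.

Lemma mulq_eq0 p q : p * q = 0 -> q != 0 -> p = 0.
Proof. by move=> pq0 /quat_unit uq; rewrite -(mulrK uq p) pq0 mul0r. Qed.

Lemma conjqM p q : conjq (p * q) = conjq q * conjq p.
Proof.
case: p q => a b c d [a' b' c' d'].
by rewrite /conjq {1 2}/GRing.mul /=; congr Quat; cbn; ring.
Qed.

Lemma conjqD p q : conjq (p + q) = conjq p + conjq q.
Proof.
case: p q => a b c d [a' b' c' d'].
by rewrite /conjq {1 2}/GRing.add /=; congr Quat; cbn; ring.
Qed.

Lemma conjqK : involutive (@conjq R).
Proof. by case=> a b c d; rewrite /conjq /= !opprK. Qed.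

Lemma conjq0 : conjq (0 : quat R) = 0.
Proof. by rewrite /conjq /= !oppr0. Qed.

Lemma conjqN p : conjq (- p) = - conjq p.
Proof. by case: p => a b c d; rewrite /GRing.opp /conjq. Qed.

Lemma conjq_sum (I : Type) (r : seq I) (P : pred I) (F : I -> quat R) :
  conjq (\sum_(i <- r | P i) F i) = \sum_(i <- r | P i) conjq (F i).
Proof. exact: (big_morph _ conjqD conjq0). Qed.

(** Gaussian elimination by induction on the number of columns: a column that vanishes on [T] is
    dropped, otherwise a pivot row clears it and leaves together with it. Coefficients stay on the
    left throughout, as the skew field requires. *)
Lemma dependent_rows (I J : finType) (S : {set J}) (T : {set I})
    (C : I -> J -> quat R) : (#|S| < #|T|)%N ->
  exists q : I -> quat R, (exists2 v, v \in T & q v != 0) /\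
    forall j, j \in S -> \sum_(v in T) q v * C v j = 0.
Proof.
move: {2}#|S| (erefl #|S|) => k; elim: k S T C => [|k IHk] S T C cS.
  rewrite cS => /card_gt0P[v vT]; exists (fun=> 1); split.
    by exists v => //; exact: oner_neq0.
  by move=> j; rewrite (cards0_eq cS) inE.
have [j jS] : exists j, j \in S by apply/card_gt0P; rewrite cS.
have cS' : #|S :\ j| = k by move: (cardsD1 j S); rewrite jS cS => -[].
move=> ltST; have [C0|] := boolP [forall v in T, C v j == 0].
  have [|q [qT qS]] := IHk _ T C cS'; first by rewrite cS' -cS ltnW.
  exists q; split=> // i iS; have [->|ij] := eqVneq i j.
    by rewrite big1 // => v vT; rewrite (eqP (forall_inP C0 v vT)) mulr0.
  by apply: qS; rewrite !inE ij.
rewrite negb_forall_in => /existsP[v0 /andP[v0T Cv0]].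
have uC := quat_unit Cv0.
pose D v i := C v i - C v j * (C v0 j)^-1 * C v0 i.
have [|q [[v1 v1T qv1] qS]] := IHk _ (T :\ v0) D cS'.
  by rewrite cS'; move: ltST; rewrite cS (cardsD1 v0 T) v0T.
(* Clearing column [j] subtracted left multiples of the pivot row; [q0] collects them, so that the
   combination of [D] becomes one of [C]. *)
pose q0 := - \sum_(v in T :\ v0) q v * C v j * (C v0 j)^-1.
exists (fun v => if v == v0 then q0 else q v); split.
  by move: v1T; rewrite !inE => /andP[/negPf nv v1T]; exists v1; rewrite ?nv.
have split_sum i : \sum_(v in T) (if v == v0 then q0 else q v) * C v i
    = \sum_(v in T :\ v0) q v * D v i.
  rewrite (big_setD1 v0) //= eqxx /q0 mulNr mulr_suml -sumrN -big_split /=.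
  apply: eq_bigr => v; rewrite !inE => /andP[/negPf -> _].
  by rewrite /D mulrBr addrC !mulrA.
move=> i iS; rewrite split_sum; have [->|ij] := eqVneq i j.
  by rewrite big1 // => v _; rewrite /D -mulrA mulVr // mulr1 subrr mulr0.
by apply: qS; rewrite !inE ij.
Qed.

End QuaternionAlgebra.

(** * Nonsingular principal submatrices of a Hermitian matrix *)

Section Nonsingular.
Variables (R : realType) (n : nat) (A : 'M[quat R]_n).
Hypothesis A_herm : forall i j, A i j = conjq (A j i).
Implicit Types H S : {set 'I_n}.

(** Left independence of the rows of the principal submatrix on [H]. *)
Definition nonsing H := forall q : 'I_n -> quat R,
  (forall h, h \in H -> \sum_(i in H) q i * A i h = 0) ->
  forall i, i \in H -> q i = 0.

Definition spanning H := forall v, exists q : 'I_n -> quat R,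
  forall w, A v w = \sum_(i in H) q i * A i w.

Lemma spanning_outside H : (forall v, v \notin H -> exists q : 'I_n -> quat R,
  forall w, A v w = \sum_(i in H) q i * A i w) -> spanning H.
Proof.
move=> outH v; have [vH|/outH//] := boolP (v \in H).
exists (fun i => (i == v)%:R) => w; rewrite (big_setD1 v) //= eqxx mul1r.
by rewrite big1 ?addr0 // => i; rewrite !inE => /andP[/negPf -> _]; rewrite mul0r.
Qed.

(** The rows of [H] are independent already on the columns of [H]; conversely, for more than [#|H|]
    rows, their coefficient vectors over the rows of [H] are dependent. *)
Lemma nonsing_rank H : nonsing H -> spanning H -> left_row_rank A = #|H|.
Proof.
move=> nsH spH; apply/eqP; rewrite eqn_leq; apply/andP; split; last first.
  apply: leq_bigmax_cond; apply/asboolP => q q0 i iH; apply: (nsH q) => // h _.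
  by move/matrixP/(_ 0 h): q0; rewrite summxE !mxE; under eq_bigr do rewrite !mxE.
apply/bigmax_leqP => T /asboolP indT; rewrite leqNgt; apply/negP => ltHT.
have [C CE] := choice spH.
have [q [[v vT /eqP qv0] qH]] := dependent_rows C ltHT; apply: qv0.
apply: indT => //; apply/rowP => w; rewrite summxE mxE.
under eq_bigr => i _ do rewrite !mxE CE mulr_sumr.
rewrite exchange_big big1 //= => i iH.
by under eq_bigr do rewrite mulrA; rewrite -mulr_suml qH // mul0r.
Qed.

(** Appending [b], indexed by [None], to the rows of [H] gives more rows than columns, hence a
    dependency. Nonsingularity makes the coefficient of [b] nonzero, so it can be divided out. *)
Lemma nonsing_solve H (b : 'I_n -> quat R) : nonsing H ->
  exists q : 'I_n -> quat R,
    forall h, h \in H -> b h = \sum_(i in H) q i * A i h.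
Proof.
move=> nsH; pose C (o : option 'I_n) h := if o is Some i then A i h else b h.
pose T := None |: [set Some i | i in H].
have NT : None \notin [set Some i | i in H] by apply/imsetP => -[].
have sumT (q : option 'I_n -> quat R) h :
    \sum_(o in T) q o * C o h = q None * b h + \sum_(i in H) q (Some i) * A i h.
  rewrite big_setU1 //=; congr (_ + _).
  by rewrite big_imset //= => i j _ _ [].
have [|q [[o oT qo] qH]] := @dependent_rows R _ _ H T C.
  by rewrite cardsU1 NT card_imset // => i j [].
have q0 : q None != 0.
  apply: contraNneq qo => q0; case: o oT => [i|]; last by rewrite q0.
  rewrite !inE /= mem_imset => [iH|i1 i2 []] //.
  apply/eqP/(nsH (q \o Some)) => // h /qH.
  by rewrite sumT q0 mul0r add0r.
exists (fun i => - ((q None)^-1 * q (Some i))) => h /qH; rewrite sumT => /eqP.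
rewrite addrC addr_eq0 => /eqP qE.
under eq_bigr do rewrite mulNr -mulrA.
by rewrite sumrN -mulr_sumr qE mulrN opprK mulKr ?quat_unit.
Qed.

(* [s u w] is the entry of the Schur complement of [A] relative to [H]; the
   coefficients [q u] eliminate row [u] on the columns of [H]. *)
Lemma schur_complement H : nonsing H ->
  exists s q : 'I_n -> 'I_n -> quat R,
  [/\ forall u w, A u w = s u w + \sum_(i in H) q u i * A i w,
      forall u h, h \in H -> s u h = 0,
      forall u w, s u w = conjq (s w u)
    & forall u, (forall h, h \in H -> A u h = 0) -> forall w, s u w = A u w].
Proof.
move=> nsH; have [q qE] := choice (fun u => nonsing_solve (A u) nsH).
pose s u w := A u w - \sum_(i in H) q u i * A i w.
exists s, q; split=> [u w|u h hH|u w|u uH w].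
- by rewrite subrK.
- by rewrite /s -qE // subrr.
(* Expanding either correction through [qE] gives the same double sum of
   [q u i * A i j * conjq (q w j)]. *)
- rewrite /s conjqD conjqN -A_herm; congr (_ - _); rewrite conjq_sum.
  under eq_bigr => i iH do rewrite A_herm (qE _ i iH) conjq_sum mulr_sumr.
  rewrite exchange_big /=; apply: eq_bigr => j jH.
  rewrite conjqM -A_herm (qE _ j jH) mulr_suml; apply: eq_bigr => i iH.
  by rewrite conjqM -A_herm mulrA.
- rewrite /s big1 ?subr0 // => i iH; rewrite (nsH (q u)) ?mul0r // => h hH.
  by rewrite -qE ?uH.
Qed.

(** A nonzero diagonal entry of the Schur complement is a pivot. The rows of [s] vanish on [H], so
    there only the shifted coefficients [p i + p u * q u i] remain and must vanish; column [u] then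
    gives [p u = 0]. *)
Lemma nonsing_setU1 H s q u :
    nonsing H ->
    (forall u w, A u w = s u w + \sum_(i in H) q u i * A i w) ->
    (forall u h, h \in H -> s u h = 0) ->
  u \notin H -> s u u != 0 -> nonsing (u |: H).
Proof.
move=> nsH AE sH uH su p pA.
have rE w : \sum_(i in u |: H) p i * A i w =
    p u * s u w + \sum_(i in H) (p i + p u * q u i) * A i w.
  rewrite big_setU1 //= AE mulrDr -addrA; congr (_ + _).
  rewrite mulr_sumr -big_split; apply: eq_bigr => i _ /=.
  by rewrite mulrDl mulrA addrC.
have p0 i : i \in H -> p i + p u * q u i = 0.
  apply: (nsH (fun i => p i + p u * q u i)) => h hH.
  have := pA h; rewrite rE sH // mulr0 add0r; apply.
  by rewrite inE hH orbT.
have pu : p u = 0.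
  apply: mulq_eq0 su; have := pA u; rewrite rE big1 ?addr0 ?setU11 => [->//|].
  by move=> i iH; rewrite p0 ?mul0r.
move=> i; rewrite inE inE => /orP[/eqP->//|iH].
by have := p0 i iH; rewrite pu mul0r addr0.
Qed.

(** With a zero diagonal entry at [u], the Schur block on [u] and [v] still has nonzero entries off
    the diagonal, [s] being Hermitian; it is a two-by-two pivot whatever [s v v] is. *)
Lemma nonsing_setU2 H s q u v :
    nonsing H ->
    (forall u w, A u w = s u w + \sum_(i in H) q u i * A i w) ->
    (forall u h, h \in H -> s u h = 0) ->
    (forall u w, s u w = conjq (s w u)) ->
  u \notin H -> v \notin u |: H -> s u u = 0 -> s u v != 0 ->
  nonsing (v |: (u |: H)).
Proof.
move=> nsH AE sH sC uH vuH suu suv p pA.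
have rE w : \sum_(i in v |: (u |: H)) p i * A i w = p v * s v w + p u * s u w
    + \sum_(i in H) (p i + p u * q u i + p v * q v i) * A i w.
  rewrite !big_setU1 //= (AE v) (AE u) !mulrDr -!addrA; congr (_ + _).
  rewrite addrCA; congr (_ + _); rewrite !mulr_sumr -!big_split.
  by apply: eq_bigr => i _ /=; rewrite !mulrDl !mulrA addrC -addrA addrCA addrA.
have p0 i : i \in H -> p i + p u * q u i + p v * q v i = 0.
  apply: (nsH (fun i => p i + p u * q u i + p v * q v i)) => h hH.
  have := pA h; rewrite rE !sH // !mulr0 !add0r; apply.
  by rewrite !inE hH !orbT.
have pw w : w \in v |: (u |: H) -> p v * s v w + p u * s u w = 0.
  move=> wS; have := pA w wS; rewrite rE big1 ?addr0 // => i iH.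
  by rewrite p0 ?mul0r.
have pv : p v = 0.
  apply: (@mulq_eq0 _ _ (s v u)); last first.
    by rewrite sC; apply: contraNneq suv => sv; rewrite -(conjqK (s u v)) sv conjq0.
  by have := pw u; rewrite suu mulr0 addr0; apply; rewrite !inE eqxx orbT.
have pu : p u = 0.
  apply: mulq_eq0 suv; have := pw v; rewrite pv mul0r add0r; apply.
  exact: setU11.
move=> i; rewrite !inE => /or3P[/eqP->//|/eqP->//|iH].
by have := p0 i iH; rewrite pu pv !mul0r !addr0.
Qed.

End Nonsingular.

(** * Growing nonsingular subgraphs *)

Section SimpleGraphLemmas.
Variables (n : nat) (G : sgraph n).
Implicit Types S H X : {set 'I_n}.

Lemma connected_closed X x : connected_graph G -> x \in X ->
  (forall y z, y \in X -> adj G y z -> z \in X) -> forall y, y \in X.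
Proof.
move=> conn xX Xcl y; have clX : closed (adj G) (mem X).
  by move=> u v uv; apply/idP/idP => /Xcl; apply; rewrite // adj_sym.
by rewrite -(closed_connect clX (conn x y)).
Qed.

Definition degree_in S v : nat := (\sum_(u in S) adj G v u)%N.

(** Twice the number of edges spanned by [S]. *)
Definition degree_sum S : nat := (\sum_(v in S) degree_in S v)%N.

Lemma degreeE v : degree G v = (\sum_w adj G v w)%N.
Proof.
by rewrite /degree -sum1_card big_mkcond; apply: eq_bigr => w _; rewrite inE; case: adj.
Qed.

Lemma degree_in_ge1 S v u : u \in S -> adj G v u -> (0 < degree_in S v)%N.
Proof. by move=> uS vu; rewrite /degree_in (big_setD1 u) //= vu. Qed.

Lemma degree_in_ge2 S v u w : u \in S -> w \in S -> u != w ->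
  adj G v u -> adj G v w -> (1 < degree_in S v)%N.
Proof.
move=> uS wS uw vu vw; rewrite /degree_in (big_setD1 u) //= (big_setD1 w) /=.
  by rewrite vu vw.
by rewrite !inE eq_sym uw.
Qed.

Lemma degree_sum_setU1 S u : u \notin S ->
  degree_sum (u |: S) = (degree_sum S + (degree_in S u).*2)%N.
Proof.
move=> uS; rewrite /degree_sum big_setU1 //= {1}/degree_in big_setU1 //=.
rewrite adj_irr add0n -/(degree_in S u) -addnn addnCA; congr addn.
rewrite addnC -big_split /=; apply: eq_bigr => v _.
by rewrite {1}/degree_in big_setU1 //= adj_sym.
Qed.

Lemma sum_degree S :
  (\sum_(v in S) degree G v = degree_sum S + \sum_(v in ~: S) degree_in S v)%N.
Proof.
under eq_bigr do rewrite degreeE.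
rewrite exchange_big (bigID (mem S)) /=; congr addn.
  by apply: eq_bigr => v _; apply: eq_bigr => u _; rewrite adj_sym.
apply: eq_big => [v|v _]; first by rewrite inE.
by apply: eq_bigr => u _; rewrite adj_sym.
Qed.

Lemma degree_le_max v : (degree G v <= max_degree G)%N.
Proof. exact: leq_bigmax_cond. Qed.

End SimpleGraphLemmas.

Section GainGraphRank.
Variables (R : realType) (n : nat) (G : gain_graph R n).
Hypothesis G_conn : connected_graph G.
Implicit Types S H X : {set 'I_n}.
Let A := adjacency G.

Lemma gain_neq0 i j : adj G i j -> gain G i j != 0.
Proof.
move=> /gain_norm; apply: contra_eq_neq => ->.
by rewrite /Defs.normq mul0r /= sqrtr0 eq_sym oner_neq0.
Qed.

Lemma adjacency_neq0 i j : (A i j != 0) = adj G i j.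
Proof. by rewrite mxE; case: ifP => [/gain_neq0|]; rewrite ?eqxx. Qed.

Lemma adjacency_herm i j : A i j = conjq (A j i).
Proof.
rewrite !mxE adj_sym; case: ifP => [ji|]; last by rewrite conjq0.
by rewrite gain_inv 1?adj_sym // normq1_inv // gain_norm.
Qed.

(** [Q] is any invariant that survives adding an adjacent vertex. [H] grows, by one vertex or by a
    pair, as long as some vertex adjacent to it has a nonzero row in the Schur complement. *)
Lemma nonsing_extend (Q : {set 'I_n} -> Prop) H :
    nonsing A H -> H != set0 -> Q H ->
    (forall S u w, Q S -> u \notin S -> w \in S -> adj G u w -> Q (u |: S)) ->
  exists S, [/\ Q S, nonsing A S, spanning A S
    & forall v, v \notin S -> exists2 w, w \in S & adj G v w].
Proof.
move=> nsH H0 QH Qstep; move: {2}#|~: H| (leqnn #|~: H|) => k.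
elim: k H nsH H0 QH => [|k IHk] H nsH H0 QH.
  rewrite leqn0 cards_eq0 => /eqP HC0; have HT v : v \in H.
    by rewrite -[H]setCK HC0 setC0 inE.
  exists H; split=> // v; last by rewrite HT.
  by move: v; apply: spanning_outside => v; rewrite HT.
move=> cH; have cardU u S : u \notin S -> (#|~: (u |: S)| < #|~: S|)%N.
  move=> uS; apply/proper_card/properP; split; first by rewrite setCS subsetUr.
  by exists u; rewrite !inE ?eqxx.
have [s [q [AE sH sC sA]]] := schur_complement adjacency_herm nsH.
pose bd u := [exists w in H, adj G u w].
have [|/existsPn sb] := boolP [exists u, [exists v, [&& u \notin H, bd u & s u v != 0]]].
  case/existsP=> u /existsP[v /and3P[uH /existsP[w /andP[wH uw]] suv]].
  have Qu : Q (u |: H) := Qstep _ _ _ QH uH wH uw.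
  have u0 : u |: H != set0 by apply/set0Pn; exists u; rewrite setU11.
  have [suu|suu] := eqVneq (s u u) 0; last first.
    apply: (IHk (u |: H)) => //; first exact: nonsing_setU1 nsH AE sH uH suu.
    by rewrite -ltnS; apply: leq_trans (cardU _ _ uH) cH.
  have vuH : v \notin u |: H.
    rewrite !inE negb_or; apply/andP; split; apply: contraNN suv.
      by move/eqP=> ->; rewrite suu.
    by move/(sH u)=> ->.
  (* If [v] has no neighbour in [H], its row is unchanged in the Schur complement; [s v u], nonzero
     by symmetry, is then an entry of [A], so [v] is adjacent to [u]. *)
  have [w' w'H vw'] : exists2 w', w' \in u |: H & adj G v w'.
    have [/existsP[w' /andP[w'H vw']]|vH] := boolP (bd v).
      by exists w' => //; rewrite inE w'H orbT.
    exists u; first exact: setU11.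
    rewrite -adjacency_neq0 -sA; last first.
      move=> h hH; apply/eqP; apply: contraNT vH; rewrite adjacency_neq0 => vh.
      by apply/existsP; exists h; rewrite hH.
    by rewrite sC; apply: contraNneq suv => svu; rewrite -(conjqK (s u v)) svu conjq0.
  apply: (IHk (v |: (u |: H))).
  - exact: nonsing_setU2 nsH AE sH sC uH vuH suu suv.
  - by apply/set0Pn; exists v; rewrite setU11.
  - exact: Qstep w'H vw'.
  by rewrite -ltnS; apply: leq_trans cH; apply: ltn_trans (cardU u H uH); apply: cardU.
have s0 u v : u \notin H -> bd u -> s u v = 0.
  move=> uH bu; have /existsPn/(_ v) := sb u.
  by rewrite uH bu /= negbK => /eqP.
(* [H] and its boundary are closed under adjacency: a vertex [z] outside both keeps its row in the
   Schur complement, and by symmetry its entry at a boundary vertex [y] is zero. *)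
have dom v : v \notin H -> bd v.
  have [x xH] := set0Pn _ H0.
  pose X := [set v | (v \in H) || bd v]; suff : v \in X.
    by rewrite inE => /orP[->|].
  apply: (@connected_closed _ _ X x G_conn); first by rewrite inE xH.
  move=> y z; rewrite !inE => yX yz; case: (boolP (z \in H)) => //= zH.
  case: (boolP (y \in H)) => yH.
    by apply/existsP; exists y; rewrite yH adj_sym.
  move: yX; rewrite (negPf yH) /= => by_; apply: contraLR yz => bz.
  rewrite -adjacency_neq0 adjacency_herm negbK -sA; last first.
    move=> h hH; apply/eqP; apply: contraNT bz; rewrite adjacency_neq0 => zh.
    by apply/existsP; exists h; rewrite hH.
  by rewrite sC s0 // conjq0 conjq0.
exists H; split=> // [|v /dom/existsP[w /andP[]]]; last by exists w.
apply: spanning_outside => v vH; by exists (q v) => w; rewrite AE s0 ?add0r // dom.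
Qed.

(** Column [x] involves only [p y]; the columns of [H] then clear the coefficients on [H], and
    column [y] clears [p x]. *)
Lemma nonsing_pendant H x y : nonsing A H -> x \notin H -> y \notin H ->
  adj G x y -> (forall h, h \in H -> ~~ adj G x h) -> nonsing A (x |: (y |: H)).
Proof.
move=> nsH xH yH xy xnH p pA.
have Ayx : A y x != 0 by rewrite adjacency_neq0 adj_sym.
have Axx : A x x = 0 by rewrite mxE adj_irr.
have A0 h : h \in H -> A x h = 0 /\ A h x = 0.
  move=> hH; rewrite adjacency_herm; suff -> : A h x = 0 by rewrite conjq0.
  by apply/eqP; apply: contraNT (xnH h hH); rewrite adjacency_neq0 adj_sym.
have xyH : x \notin y |: H.
  by rewrite !inE negb_or xH andbT; apply: contraTneq xy => ->; rewrite adj_irr.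
have pE w : w \in x |: (y |: H) ->
    p x * A x w + (p y * A y w + \sum_(i in H) p i * A i w) = 0.
  by move=> /pA; rewrite !big_setU1.
have py : p y = 0.
  apply: mulq_eq0 Ayx; have := pE x (setU11 _ _).
  by rewrite Axx mulr0 add0r big1 ?addr0 // => i /A0[_ ->]; rewrite mulr0.
have pH : forall i, i \in H -> p i = 0.
  apply: nsH => h hH; have := pE h; rewrite (A0 h hH).1 py mulr0 mul0r !add0r.
  by apply; rewrite !inE hH !orbT.
have px : p x = 0.
  apply: (@mulq_eq0 _ _ (A x y)); last by rewrite adjacency_neq0.
  have := pE y; rewrite py mul0r add0r big1 ?addr0; last by move=> i /pH ->; rewrite mul0r.
  by apply; rewrite !inE eqxx orbT.
by move=> i; rewrite !inE => /or3P[/eqP->|/eqP->|/pH].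
Qed.

(** * Consequences of equality in the rank bound *)

Section EqualityCase.
Hypothesis rank_eq : (gain_rank G * max_degree G + 2 = n + gain_rank G)%N.
Let D := max_degree G.

(* Double counting the edges leaving [S]: equality leaves no slack. *)
Lemma extremal_extension (Q : {set 'I_n} -> Prop) H :
    nonsing A H -> H != set0 -> Q H ->
    (forall S u w, Q S -> u \notin S -> w \in S -> adj G u w -> Q (u |: S)) ->
  exists S, [/\ Q S, spanning A S, #|S| = gain_rank G
    & (degree_sum G S + \sum_(v in ~: S) (degree_in G S v).-1
        + \sum_(v in S) (D - degree G v) + 2 = #|S|.*2)%N].
Proof.
move=> nsH H0 QH Qstep.
have [S [QS nsS spS domS]] := nonsing_extend nsH H0 QH Qstep.
have rS : #|S| = gain_rank G by rewrite -(nonsing_rank nsS spS).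
exists S; split=> //.
have sumD : (\sum_(v in S) degree G v + \sum_(v in S) (D - degree G v) = #|S| * D)%N.
  rewrite -big_split -sum_nat_const; apply: eq_bigr => v _ /=.
  by rewrite subnKC // degree_le_max.
have sumC : (\sum_(v in ~: S) degree_in G S v =
    #|~: S| + \sum_(v in ~: S) (degree_in G S v).-1)%N.
  rewrite -sum1_card -big_split; apply: eq_bigr => v /=; rewrite inE => /domS[w wS vw].
  by rewrite add1n prednK // (degree_in_ge1 wS vw).
have cS := cardsC S; rewrite card_ord in cS.
(* The product [r D] equals [degree_sum] plus n - r plus the two slack sums, and [rank_eq] turns r D
   - (n - r) into 2 r - 2. *)
move: sumD; rewrite sum_degree sumC rS => sumD; move: rank_eq cS; rewrite -/D rS.
set x := (gain_rank G * D)%N in sumD *; lia.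
Qed.

Section TightSubgraph.
Variable H : {set 'I_n}.
Hypotheses (nsH : nonsing A H) (H0 : H != set0).
(** At least [#|H|] - 1 edges, a bound kept when adjacent vertices are added; in the count of
    [extremal_extension] it forces both slack sums to be zero. *)
Hypothesis sparseH : (#|H|.*2 <= degree_sum G H + 2)%N.

Lemma tight_degree h : h \in H -> degree G h = D.
Proof.
move=> hH; pose Q S := H \subset S /\ (#|S|.*2 <= degree_sum G S + 2)%N.
have [||S [[HS QS] _ _ cnt]] := @extremal_extension Q H nsH H0.
- by split.
- move=> S u w [HS QS] uS wS uw; split; first exact: subset_trans HS (subsetUr _ _).
  rewrite degree_sum_setU1 // cardsU1 uS; have := degree_in_ge1 wS uw; lia.
have hS := subsetP HS h hH.
move: cnt; rewrite [X in (_ + X + 2)%N](big_setD1 h) //=.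
have := degree_le_max G h; rewrite -/D; move: QS.
by move: (\sum_(v in _) _)%N (\sum_(v in _) _)%N #|_| => x y t; lia.
Qed.

Lemma tight_unique_neighbor w h1 h2 : w \notin H -> h1 \in H -> h2 \in H ->
  adj G w h1 -> adj G w h2 -> h1 = h2.
Proof.
move=> wH h1H h2H wh1 wh2; apply/eqP; apply: contraT => h12.
have ge2 S : H \subset S -> (1 < degree_in G S w)%N.
  by move=> /subsetP HS; apply: degree_in_ge2 h12 wh1 wh2; apply: HS.
(* Adding [w] brings at least two edges, after which [S] spans at least [#|S|] edges, too many for
   equality; if [w] is never added, its second neighbour counts in the slack outside [S]. *)
pose Q S := H \subset S /\ (#|S|.*2 + (w \in S).*2 <= degree_sum G S + 2)%N.
have [||S [[HS QS] _ _ cnt]] := @extremal_extension Q H nsH H0.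
- by split=> //; rewrite (negPf wH) addn0.
- move=> S u v [HS QS] uS vS uv; split; first exact: subset_trans HS (subsetUr _ _).
  rewrite degree_sum_setU1 // cardsU1 uS in_setU1.
  have := degree_in_ge1 vS uv; have := ge2 S HS.
  have [wu|_] := eqVneq w u; last by lia.
  by rewrite wu (negPf uS) in QS *; lia.
exfalso; have := ge2 S HS; have [wS|wS] := boolP (w \in S).
  by rewrite wS in QS; lia.
move: cnt; rewrite [X in (_ + X + _ + 2)%N](big_setD1 w) ?inE //=.
move: QS; rewrite (negPf wS).
by move: (\sum_(v in _) _)%N (\sum_(v in _) _)%N => x y /=; rewrite double0 addn0; lia.
Qed.

(** The set of size r grown from [H] contains [H], so it is [H] itself. *)
Lemma tight_spanning : #|H| = gain_rank G -> spanning A H.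
Proof.
move=> rH; have [//|//|S [HS spS rS _]] :=
  @extremal_extension (fun S => H \subset S) H nsH H0.
  by move=> S u v HS _ _ _; apply: subset_trans HS (subsetUr _ _).
by suff -> : H = S by []; apply/eqP; rewrite eqEcard HS rH rS leqnn.
Qed.

End TightSubgraph.
End EqualityCase.
End GainGraphRank.

(** * Longest even induced paths *)

Section InducedPaths.
Variables (n : nat) (G : sgraph n).
Implicit Types p q c : seq 'I_n.

(** Each vertex is compared with the later ones only; symmetry of [adj] covers the other pairs. *)
Fixpoint induced_path p : bool :=
  if p is x :: p' then
    [&& x \notin p', all (fun y => adj G x y == (y == head x p')) p'
      & induced_path p']
  else true.

Lemma induced_path_cons x p : x \notin p ->
  (forall z, z \in p -> adj G x z = (z == head x p)) ->
  induced_path p -> induced_path (x :: p).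
Proof. by move=> /= -> xp ->; rewrite andbT; apply/allP => z /xp ->. Qed.

Lemma induced_path_rcons p y : y \notin p ->
  (forall z, z \in p -> adj G y z = (z == last y p)) ->
  induced_path p -> induced_path (rcons p y).
Proof.
elim: p => [//|x p IHp] yxp yadj /= /and3P[xp xadj ipp].
move: yxp; rewrite inE negb_or => /andP[yx yp].
rewrite mem_rcons inE eq_sym negb_or yx xp /= all_rcons -andbA; apply/and3P; split.
- rewrite adj_sym yadj ?mem_head //=; case: (p) xp yp => [|w p'] /=.
    by rewrite !eqxx.
  rewrite !inE !negb_or => /andP[xw xp'] /andP[yw yp'].
  rewrite (negPf yw); apply/eqP/negP => /eqP xl.
  by have := mem_last w p'; rewrite -xl inE (negPf xw) (negPf xp').
- by apply/allP => z zp; rewrite (eqP (allP xadj z zp)); case: (p) zp.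
apply: IHp => // z zp; rewrite yadj ?inE ?zp ?orbT //=.
by case: (p) zp.
Qed.

Lemma induced_path_uniq p : induced_path p -> uniq p.
Proof. by elim: p => //= x p IHp /and3P[-> _ /IHp]. Qed.

Lemma induced_path_path x p : induced_path (x :: p) -> path (adj G) x p.
Proof.
elim: p x => //= y p IHp x /and3P[_ /andP[/eqP xy _] ipp].
by rewrite xy eqxx IHp.
Qed.

Lemma induced_path_last x p z1 z2 : induced_path (x :: p) ->
  z1 \in x :: p -> z2 \in x :: p ->
  adj G (last x p) z1 -> adj G (last x p) z2 -> z1 = z2.
Proof.
elim: p x => [|y p IHp] x ip.
  by rewrite !inE => /eqP -> _ /=; rewrite adj_irr.
have /and3P[xp /allP xadj ipy] := ip.
(* If the head is adjacent to the last vertex, that vertex is [y] and [p] is empty; then [z] is [y]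
   too, and [y] would carry a loop. *)
have lastx z : z \in y :: p -> adj G (last y p) x -> adj G (last y p) z -> x = z.
  rewrite adj_sym (eqP (xadj _ (mem_last y p))) => zp /eqP ly.
  have p0 : p = [::].
    have := induced_path_uniq (ipy : induced_path (y :: p)).
    by case: (p) ly => //= w p' <-; rewrite mem_last.
  by move: zp; rewrite p0 inE => /eqP -> /=; rewrite adj_irr.
rewrite 2![_ \in x :: _]inE => /orP[/eqP->|z1p] /orP[/eqP->|z2p] //= l1 l2.
- exact: lastx.
- by apply/esym; apply: lastx.
- exact: IHp ipy z1p z2p l1 l2.
Qed.

Lemma induced_path_sparse p : induced_path p ->
  (#|[set z in p]|.*2 <= degree_sum G [set z in p] + 2)%N.
Proof.
have nil0 : [set z : 'I_n in [::]] = set0 by apply/setP => z; rewrite !inE.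
elim: p => [|x p IHp] ip; first by rewrite nil0 cards0.
have -> : [set z in x :: p] = x |: [set z in p] by apply/setP => z; rewrite !inE.
have /= /and3P[xp xadj ipp] := ip; have xp' : x \notin [set z in p] by rewrite inE.
rewrite degree_sum_setU1 // cardsU1 xp'; have := IHp ipp.
case: p {IHp ip ipp xp xp'} xadj => [|y p] /= xadj.
  by move=> _; rewrite nil0 cards0 addn0 addn2.
have : (0 < degree_in G [set z in y :: p] x)%N.
  by apply: (@degree_in_ge1 _ _ _ _ y); rewrite ?inE ?eqxx //; case/andP: xadj => /eqP ->.
by move: #|_| (degree_sum _ _) (degree_in _ _ _) => s t d; lia.
Qed.

End InducedPaths.
Lemma head_neq_last (T : eqType) (a : T) p : uniq (a :: p) -> p != [::] ->
  a != last a p.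
Proof.
case: p => //= b p /andP[ap _] _; apply: contraNneq ap => ->; exact: mem_last.
Qed.

(** * Regular graphs where an outside vertex sees at most one vertex of an even induced path *)

Section RegularGraphs.
Variables (n : nat) (G : sgraph n).
Implicit Types p q c : seq 'I_n.

Lemma next_next_neq c i : uniq c -> (3 <= size c)%N -> i \in c ->
  next c (next c i) != i.
Proof.
move=> uc sc /rot_to[k s ck].
rewrite -!(next_rot k uc) ck; have us : uniq (i :: s) by rewrite -ck rot_uniq.
have : (3 <= size (i :: s))%N by rewrite -ck size_rot.
case: s us {ck} => [|y [|z s]] //= us _; rewrite eqxx.
move: us; rewrite !inE !negb_or -!andbA => /and4P[iy iz _ _].
by rewrite [y == i]eq_sym (negPf iy) eqxx eq_sym.
Qed.

(** The two cycle neighbours of a vertex of [c] exhaust its degree, so [c] is closed under adjacency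
    and, by connectedness, contains every vertex. *)
Lemma two_regular_cycle c : connected_graph G -> (forall v, degree G v = 2) ->
  is_cycle_in G c -> is_cycle_graph G c.
Proof.
move=> conn deg2 [sc uc cc].
have nbr i : i \in c -> [set j | adj G i j] = [set next c i; prev c i].
  move=> ic; apply/esym/eqP; rewrite eqEcard; apply/andP; split.
    apply/subsetP => j; rewrite !inE => /orP[] /eqP ->; first exact: next_cycle.
    by rewrite adj_sym prev_cycle.
  rewrite [X in (X <= _)%N]deg2 cards2; case: eqVneq => // nxt.
  by have := next_next_neq uc sc ic; rewrite nxt next_prev // eqxx.
have allc i : i \in c.
  have [x xc] : exists x, x \in c by case: (c) sc => // x s _; exists x; apply: mem_head.
  suff : i \in [set z in c] by rewrite inE.
  apply: (connected_closed (x := x) conn); rewrite ?inE // => y z; rewrite !inE => yc yz.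
  have : z \in [set j | adj G y j] by rewrite inE.
  by rewrite nbr // !inE => /orP[] /eqP ->; rewrite ?mem_next ?mem_prev.
split=> // i j; have := nbr i (allc i) => /setP/(_ j); rewrite !inE => ->.
by rewrite -(can2_eq (prev_next uc) (next_prev uc)) [i == _]eq_sym.
Qed.

Hypotheses (G_conn : connected_graph G) (Delta_ge2 : (2 <= max_degree G)%N).
Let D := max_degree G.
Hypothesis G_reg : forall v, degree G v = D.
Hypothesis path_nbr : forall p w h1 h2, induced_path G p -> ~~ odd (size p) ->
  w \notin p -> h1 \in p -> h2 \in p -> adj G w h1 -> adj G w h2 -> h1 = h2.

Definition longest_even_path p := [/\ induced_path G p, ~~ odd (size p)
  & forall q, induced_path G q -> ~~ odd (size q) -> (size q <= size p)%N].

Lemma neighbor_outside v (X : {set 'I_n}) : (#|X| < D)%N ->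
  exists2 z, z \notin X & adj G v z.
Proof.
rewrite -(G_reg v) => ltX; have : ~~ ([set j | adj G v j] \subset X).
  by apply: contraL ltX => /subset_leq_card; rewrite -leqNgt.
by move=> /subsetPn[z]; rewrite inE => vz zX; exists z.
Qed.

(** Otherwise [x] in front and [y] at the end would give a longer even induced path. *)
Lemma longest_ends_adj a p x y : p != [::] -> longest_even_path (a :: p) ->
  x \notin a :: p -> adj G x a -> y \notin a :: p -> adj G y (last a p) ->
  adj G x y.
Proof.
move=> p0 [ip ep maxp] xP xa yP yd; apply: contraT => xy.
have lp : last a p \in a :: p := mem_last a p.
have ad := head_neq_last (induced_path_uniq ip) p0.
have adjE w h z : w \notin a :: p -> h \in a :: p -> adj G w h -> z \in a :: p ->
    adj G w z = (z == h).
  move=> wP hP wh zP; apply/idP/eqP => [wz|->//].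
  exact: path_nbr ip ep wP zP hP wz wh.
have xy0 : x != y.
  apply: contraNneq ad => exy; rewrite -exy in yd.
  by apply/eqP; exact: path_nbr ip ep xP (mem_head a p) lp xa yd.
have ipx : induced_path G (x :: rcons (a :: p) y).
  apply: induced_path_cons.
  - by rewrite mem_rcons inE negb_or xy0.
  - move=> z; rewrite mem_rcons inE => /orP[/eqP ->|zP] /=; last first.
      exact: adjE xP (mem_head a p) xa zP.
    rewrite (negPf xy); apply/esym/negP => /eqP ya.
    by rewrite ya mem_head in yP.
  - apply: (@induced_path_rcons _ _ (a :: p)) => // z zP; exact: adjE yP lp yd zP.
have := maxp _ ipx; rewrite /= size_rcons /= negbK => /(_ ep).
by rewrite ltnNge leqnSn.
Qed.

Lemma neighbors_end_card a p : induced_path G (a :: p) ->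
  (D <= #|[set j | adj G (last a p) j] :\: [set z in a :: p]|.+1)%N.
Proof.
move=> ip; rewrite -(G_reg (last a p)) /degree -(cardsID [set z in a :: p]) addnC -addn1.
rewrite leq_add2l; apply/card_le1_eqP => z1 z2; rewrite !in_setI !in_set.
by move=> /andP[l1 z1p] /andP[l2 z2p]; apply: (induced_path_last ip).
Qed.

Lemma last_outer_neighbor a p : induced_path G (a :: p) ->
  exists2 y, y \notin a :: p & adj G y (last a p).
Proof.
move=> /neighbors_end_card cY; have := leq_trans Delta_ge2 cY.
rewrite ltnS => /card_gt0P[y]; rewrite !in_setD !in_set => /andP[yP dy].
by exists y; rewrite // adj_sym.
Qed.

Lemma head_outer_neighbor a p : induced_path G (a :: p) ->
  exists2 x, x \notin a :: p & adj G x a.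
Proof.
move=> /and3P[_ /allP aadj _].
have [|x xb ax] := @neighbor_outside a [set head a p]; first by rewrite cards1.
exists x; last by rewrite adj_sym.
apply: contraNN xb; rewrite inE => /orP[/eqP xa|/aadj].
  by rewrite xa adj_irr in ax.
by rewrite ax inE => /eqP/esym.
Qed.

(** [x] is adjacent to [a] and to the outer neighbours of the last vertex, at least [D] - 1 in
    number; these exhaust its degree, so [z] is among them. *)
Lemma longest_second_neighbor a p x z : p != [::] -> longest_even_path (a :: p) ->
  x \notin a :: p -> adj G x a -> z \notin a :: p -> adj G x z ->
  adj G z (last a p).
Proof.
move=> p0 lP xP xa zP xz; apply: contraT => zd.
have [ip ep _] := lP; have := neighbors_end_card ip.
set Y := _ :\: _ => cY.
have : (a |: (z |: Y)) \subset [set j | adj G x j].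
  apply/subsetP => w; rewrite in_setU1 in_setU1 => /or3P[/eqP->|/eqP->|]; rewrite ?inE //.
  rewrite negb_or => /andP[wP dw]; apply: longest_ends_adj p0 lP xP xa _ _.
    by rewrite inE negb_or.
  by rewrite adj_sym.
move=> /subset_leq_card; rewrite -/(degree G x) G_reg => cU.
suff : (#|a |: (z |: Y)| = #|Y|.+2)%N by lia.
rewrite !cardsU1 !inE eqxx (adj_sym G _ z) (negPf zd) !andbF !orbF.
by rewrite /= (contraNneq _ zP) // => <-; apply: mem_head.
Qed.

Lemma exists_longest_even_path : (0 < n)%N ->
  exists a b p, longest_even_path (a :: b :: p).
Proof.
move=> n0; pose P k := `[< exists p, [/\ induced_path G p, ~~ odd (size p) & size p = k] >].
have exP : exists k, P k by exists 0%N; apply/asboolP; exists [::].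
have ubP k : P k -> (k <= n)%N.
  move=> /asboolP[p [ip _ <-]]; rewrite -(card_uniqP (induced_path_uniq ip)).
  by rewrite -[X in (_ <= X)%N]card_ord max_card.
case: (ex_maxnP exP ubP) => k /asboolP[p [ip ep sp]] maxk.
have lP : longest_even_path p.
  by split=> // q iq eq; rewrite sp; apply: maxk; apply/asboolP; exists q.
case: p lP {ip ep sp} => [|a [|b p]]; last by exists a, b, p.
  case=> _ _ /(_ _ _ _)/= max0; pose v := Ordinal n0.
  have [|z _ vz] := @neighbor_outside v set0; first by rewrite cards0; apply: ltnW.
  have := max0 [:: v; z]; rewrite /= !inE vz eqxx !andbT.
  suff -> : v != z by move=> /(_ isT isT).
  by apply: contraTneq vz => ->; rewrite adj_irr.
by case.
Qed.

(* Replacing the first vertex of the path by an outer neighbour of the last one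
   gives another longest path, so the outer neighbours of its two ends are
   again completely joined. *)
Lemma longest_even_path_degree2 a b e p :
  longest_even_path [:: a, b, e & p] -> D = 2.
Proof.
move=> lP; apply/eqP; rewrite eqn_leq [(2 <= D)%N]Delta_ge2 andbT leqNgt; apply/negP => D3.
have [ip ep maxp] := lP; set P := [:: a, b, e & p] in lP ip ep maxp *.
set d := last a [:: b, e & p]; have dP : d \in P := mem_last a _.
have bP : b \in P by rewrite !inE eqxx orbT.
have up := induced_path_uniq ip.
have da : d != a by rewrite eq_sym; exact: head_neq_last up isT.
have db : d != b by rewrite eq_sym; apply: (@head_neq_last _ b (e :: p)) => //; case/andP: up.
have [x xP xa] := head_outer_neighbor ip.
have [y yP yd] := last_outer_neighbor ip; rewrite -/d in yd.
(* A third neighbour of [b], besides [a] and [e], exists because [D] is at least 3. *)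
have [z zP zb] : exists2 z, z \notin P & adj G z b.
  have [|z zac bz] := @neighbor_outside b [set a; e]; first by rewrite cards2; case: (_ != _).
  exists z; last by rewrite adj_sym.
  have /and3P[_ _ /and3P[_ /allP badj _]] := ip.
  apply: contraNN zac; rewrite !inE => /or3P[->//|/eqP zb|].
    by rewrite zb adj_irr in bz.
  by rewrite -in_cons => /badj; rewrite bz => /eqP/esym ->; rewrite orbT.
have xy := @longest_ends_adj a [:: b, e & p] x y isT lP xP xa yP yd.
have yz : y != z.
  apply: contraNneq db => eyz; rewrite eyz in yd.
  by apply/eqP; exact: path_nbr ip ep zP dP bP yd zb.
have xney : x != y.
  apply: contraNneq da => exy; rewrite -exy in yd.
  by apply/eqP; exact: path_nbr ip ep xP dP (mem_head _ _) yd xa.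
have ip2 : induced_path G [:: b, e & p] by case/and3P: ip.
have lP' : longest_even_path (b :: rcons (e :: p) y).
  split.
  - apply: (@induced_path_rcons _ _ [:: b, e & p]) => //.
      by move: yP; rewrite inE negb_or => /andP[].
    move=> w wp; have wP : w \in P by rewrite inE wp orbT.
    by apply/idP/eqP => [yw|->//]; apply: path_nbr ip ep yP wP dP yw yd.
  - by move: ep; rewrite /= size_rcons.
  - by move=> q iq eq; apply: leq_trans (maxp q iq eq) _; rewrite /= size_rcons.
have notP' w : w \notin P -> w != y -> w \notin b :: rcons (e :: p) y.
  rewrite /P inE negb_or => /andP[_ wp] wy.
  rewrite -rcons_cons mem_rcons inE negb_or wy //.
have zx : adj G z x.
  apply: longest_ends_adj lP' _ zb _ _ => //; first by apply: notP'; rewrite // eq_sym.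
    exact: notP'.
  by rewrite last_rcons.
(* As a neighbour of [x] off the path, [z] must see [d]; but it already sees [b], and only one
   vertex of the path is allowed. *)
have zd : adj G z d.
  by apply: (@longest_second_neighbor a [:: b, e & p] x z isT lP xP xa zP); rewrite adj_sym.
by case/eqP: db; exact: path_nbr ip ep zP dP bP zd zb.
Qed.

(** Outer neighbours of the two ends are adjacent and close the path to a cycle, which is everything
    by 2-regularity. *)
Lemma longest_even_path_cycle a p : p != [::] -> D = 2 -> longest_even_path (a :: p) ->
  exists x y, is_cycle_graph G (x :: rcons (a :: p) y).
Proof.
move=> p0 D2 lP; have [ip ep _] := lP; have up := induced_path_uniq ip.
have [y yP yd] := last_outer_neighbor ip.
have [x xP xa] := head_outer_neighbor ip.
have ad := head_neq_last up p0.
exists x, y; apply: two_regular_cycle => // [v|]; first by rewrite G_reg.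
split; first by rewrite /= size_rcons; case: (p) p0.
  rewrite cons_uniq rcons_uniq yP mem_rcons inE negb_or xP up !andbT.
  apply: contraNneq ad => exy; rewrite -exy in yd.
  by apply/eqP; exact: path_nbr ip ep xP (mem_head a p) (mem_last _ _) xa yd.
rewrite /cycle -cat1s -cats1 !cats1 /= xa rcons_path rcons_path (induced_path_path ip) /=.
rewrite last_rcons adj_sym yd adj_sym; exact: longest_ends_adj p0 lP xP xa yP yd.
Qed.

(** Every edge is now a longest even induced path, so [longest_second_neighbor] gives equal
    neighbourhoods to vertices with a common neighbour. The neighbourhoods of [b] and [a] are then
    the two sides. *)
Lemma longest_edge_bipartite a b :
  longest_even_path [:: a; b] -> is_complete_bipartite G n./2 n./2.
Proof.
move=> lP; have [ip _ maxp] := lP.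
have edge_path u v : adj G u v -> induced_path G [:: u; v].
  by move=> uv; rewrite /= inE uv eqxx !andbT; apply: contraTneq uv => ->; rewrite adj_irr.
have sub u v x z : adj G u v -> adj G x u -> adj G x z -> adj G v z.
  move=> uv xu xz; have iuv := edge_path u v uv.
  have [->//|xv] := eqVneq v x.
  have xP : x \notin [:: u; v].
    rewrite !inE negb_or [x == v]eq_sym xv andbT.
    by apply: contraTneq xu => ->; rewrite adj_irr.
  have [zP|zP] := boolP (z \in [:: u; v]).
    move: zP; rewrite !inE => /orP[/eqP->|/eqP zv]; first by rewrite adj_sym.
    have euv : u = v.
      by apply: (@path_nbr [:: u; v] x u v iuv isT xP); rewrite ?inE ?eqxx ?orbT // -zv.
    by rewrite euv adj_irr in uv.
  have luv : longest_even_path [:: u; v] by split.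
  by rewrite adj_sym; apply: (longest_second_neighbor _ luv xP xu zP xz).
have nbrE u v x z : adj G u v -> adj G x u -> adj G x z = adj G v z.
  move=> uv xu; apply/idP/idP; first exact: sub uv xu.
  by apply: (@sub u); rewrite adj_sym.
have ab : adj G a b by case/and3P: ip => _ /andP[/eqP ->]; rewrite eqxx.
pose X := [set j | adj G b j].
have cover z : z \in X :|: [set j | adj G a j].
  apply: (connected_closed (x := a) G_conn); first by rewrite !inE adj_sym ab.
  move=> u v; rewrite !inE => /orP[bu|au] uv.
    have -> : adj G a v = adj G u v; last by rewrite uv orbT.
    by apply: (@nbrE b); rewrite // adj_sym.
  have -> : adj G b v = adj G u v; last by rewrite uv.
  by apply: (@nbrE a); rewrite // adj_sym.
have XC : ~: X = [set j | adj G a j].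
  apply/setP => z; have := cover z; rewrite !inE; case bz: (adj G b z) => //= _.
  apply/esym/negP => az; have iab := edge_path a b ab.
  have zP : z \notin [:: a; b].
    rewrite !inE negb_or; apply/andP.
    by split; [move: az|move: bz]; apply: contraTneq => ->; rewrite adj_irr.
  have eab : a = b.
    by apply: (@path_nbr [:: a; b] z a b iab isT zP); rewrite ?inE ?eqxx ?orbT // adj_sym.
  by rewrite eab adj_irr in ab.
have cX : #|X| = D := G_reg b; have cXC : #|~: X| = D by rewrite XC; exact: G_reg a.
have nD : n./2 = D.
  by have := cardsC X; rewrite cX cXC card_ord => <-; rewrite addnn doubleK.
exists X; split; rewrite ?nD // => i j.
have memC z : (z \in X) = ~~ adj G a z.
  by rewrite -[X]setCK in_setC XC inE.
have := cover i; rewrite !inE => /orP[bi|ai].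
  rewrite bi (_ : adj G i j = adj G a j); last by apply: (@nbrE b); rewrite // adj_sym.
  by have := memC j; rewrite inE => ->; rewrite negbK.
rewrite (_ : adj G i j = adj G b j); last by apply: (@nbrE a); rewrite // adj_sym.
by have := memC i; rewrite inE ai => ->; case: adj.
Qed.

End RegularGraphs.

(** * Gain cycles *)

Lemma traject_next (T : eqType) (f : T -> T) x (s : seq T) : uniq (x :: s) ->
  next (x :: s) =1 f -> rcons (x :: s) x = traject f x (size s).+2.
Proof.
move=> us nf; have : fcycle f (x :: s).
  rewrite -(eq_cycle (e := frel (next (x :: s)))) ?cycle_next // => y z.
  by congr (_ == z); exact: nf.
move=> /fpathP[j sj]; have := congr1 size sj.
by rewrite size_rcons size_traject => cj; rewrite rcons_cons sj -cj.
Qed.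

Lemma rot_traject_next (T : eqType) (c : seq T) x : uniq c -> x \in c ->
  iter (size c) (next c) x = x /\
  exists k, rot k c = traject (next c) x (size c).
Proof.
move=> uc /rot_to[k s ck]; have us : uniq (x :: s) by rewrite -ck rot_uniq.
have sc : size c = (size s).+1 by rewrite -(size_rot k) ck.
have := traject_next us (f := next c); rewrite -sc trajectSr -ck => tr.
have /rcons_inj[xs xx] := tr (next_rot k uc).
by split; [rewrite -xx | exists k].
Qed.

Section GainCycles.
Variables (R : realType) (n : nat) (G : gain_graph R n) (c : seq 'I_n).
Hypothesis c_cycle : is_cycle_graph G c.
Let A := adjacency G.
Let f := next c.
Let m := size c.

Let uc : uniq c. Proof. by case: c_cycle => -[]. Qed.
Let m3 : (3 <= m)%N. Proof. by case: c_cycle => -[]. Qed.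
Let memc i : i \in c. Proof. by case: c_cycle. Qed.
Let adjE i j : adj G i j = (j == f i) || (i == f j).
Proof. by case: c_cycle. Qed.
Let f_inj : injective f. Proof. exact: can_inj (prev_next uc). Qed.

Let iter_size x : iter m f x = x.
Proof. by have [] := rot_traject_next uc (memc x). Qed.

Let iter_eq x i j : (i < m)%N -> (j < m)%N -> (iter i f x == iter j f x) = (i == j).
Proof.
move=> im jm; have [_ [k ck]] := rot_traject_next uc (memc x).
have ut : uniq (traject f x m) by rewrite -ck rot_uniq.
by rewrite -(nth_traject f im) -(nth_traject f jm) nth_uniq ?size_traject.
Qed.

Lemma prev_iter x : prev c x = iter m.-1 f x.
Proof.
by rewrite -[in LHS](iter_size x) -{1}(ltn_predK m3) iterS prev_next.
Qed.

Lemma cycle_graph_order : m = n.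
Proof.
by rewrite -(card_ord n) /m -(card_uniqP uc); apply: eq_card => i; rewrite memc.
Qed.

Lemma cycle_graph_max_degree : max_degree G = 2.
Proof.
have deg2 i : degree G i = 2.
  have -> : degree G i = #|[set next c i; prev c i]|.
    apply: eq_card => j; rewrite !inE adjE.
    by rewrite -(can2_eq (prev_next uc) (next_prev uc)) [i == _]eq_sym eq_sym.
  rewrite cards2; case: eqVneq => // nxt.
  by have := next_next_neq uc m3 (memc i); rewrite nxt next_prev // eqxx.
have [i _] : exists i : 'I_n, true by move: m3; rewrite /m; case: (c) => // i; exists i.
apply/eqP; rewrite eqn_leq -{2}(deg2 i) degree_le_max andbT.
by apply/bigmax_leqP => j _; rewrite deg2.
Qed.

Lemma cycle_graph_induced_path x k : (k < m)%N -> induced_path G (traject f x k).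
Proof.
elim: k x => [//|k IHk] x km; rewrite trajectS.
have xt : x \notin traject f (f x) k.+1.
  apply/trajectP => -[i ik] xi.
  have := @iter_eq x 0 i.+1 (ltn_trans (ltn0Sn _) m3); rewrite iterSr -xi eqxx.
  by move=> /(_ (leq_ltn_trans ik km)).
apply: induced_path_cons; last exact/IHk/ltnW.
  by move: xt; rewrite trajectSr mem_rcons inE negb_or => /andP[].
move=> z zt; have -> : head x (traject f (f x) k) = f x by case: (k) zt.
rewrite adjE; case: (x =P f z) => [xz|]; last by rewrite orbF.
case/negP: xt; rewrite trajectS inE; apply/orP; right.
rewrite [X in X \in _]xz; have /trajectP[i ik ->] := zt.
by apply/trajectP; exists i; rewrite // -iterS iterSr.
Qed.

Definition walk_gain x k : quat R :=
  \prod_(i < k) gain G (iter i f x) (iter i.+1 f x).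

Lemma walk_gainS x k :
  walk_gain x k.+1 = walk_gain x k * gain G (iter k f x) (iter k.+1 f x).
Proof. by rewrite /walk_gain big_ord_recr. Qed.

Let adj_next i : adj G i (f i). Proof. by rewrite adjE eqxx. Qed.

Lemma gain_mulC i j : adj G i j -> gain G i j * gain G j i = 1.
Proof.
move=> ij; rewrite (gain_inv ij) mulVr //.
by apply/quat_unit/gain_neq0; rewrite adj_sym.
Qed.

Let E x j w := walk_gain x j *+ (w == iter j f x).

(** The backward entry of the row cancels the last factor of the walk gain, so both entries are
    again gains of walks from [x]. *)
Let walk_row x k w : (0 < k < m)%N ->
  walk_gain x k * A (iter k f x) w = E x k.+1 w + E x k.-1 w.
Proof.
case: k => // k /= km; rewrite /E !mxE adjE.
have nxt : iter k.+2 f x != iter k f x.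
  by rewrite !iterS; exact: next_next_neq.
have -> : (iter k.+1 f x == f w) = (w == iter k f x).
  by rewrite iterS (inj_eq f_inj) eq_sym.
have -> : (w == f (iter k.+1 f x)) = (w == iter k.+2 f x) by [].
have [->|_] := eqVneq w (iter k.+2 f x).
  by rewrite (negPf nxt) orTb mulr1n mulr0n addr0 -walk_gainS.
rewrite mulr0n add0r orFb; case: eqP => [->|_]; last by rewrite mulr0 mulr0n.
by rewrite mulr1n walk_gainS -mulrA gain_mulC ?mulr1.
Qed.

(* Along the cycle, the rows weighted by the gains from [x] telescope to two
   entries, at the two neighbours of [x]. *)
Lemma cycle_row_relation x : ~~ odd m ->
  exists q k, [/\ forall w, A x w = \sum_i q i * A i w + k *+ (w == prev c x),
    q x = 0, q (next c x) = 0, q (prev c x) = 0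
    & k = 0 <-> walk_gain x m = (-1) ^+ m./2].
Proof.
move=> em; pose T := m./2.-1.
have mT : m = T.*2.+2.
  have := odd_double_half m; rewrite (negPf em) add0n /T => <-.
  by case: (m./2) (half_leq m3) => // k _; rewrite doubleK.
(* The rows of the vertices at even distances 2, 4, ..., 2T from [x], with alternating signs,
   telescope to [E x 1] and [E x T.*2.+1]; the latter sits at [prev c x]. *)
pose q i : quat R :=
  \sum_(t < T) ((-1) ^+ t * walk_gain x t.*2.+2) *+ (i == iter t.*2.+2 f x).
have y_iter : prev c x = iter T.*2.+1 f x by rewrite prev_iter mT.
have qE w : \sum_i q i * A i w = E x 1 w - (-1) ^+ T * E x T.*2.+1 w.
  transitivity (\sum_(t < T) (-1) ^+ t * (walk_gain x t.*2.+2 * A (iter t.*2.+2 f x) w)).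
    under eq_bigr do rewrite mulr_suml.
    rewrite exchange_big; apply: eq_bigr => t _ /=.
    rewrite (bigD1 (iter t.*2.+2 f x)) //= eqxx mulr1n big1 ?addr0 ?mulrA //.
    by move=> i /negPf ->; rewrite mulr0n mul0r.
  have : (T.*2.+1 < m)%N by rewrite mT.
  elim: (T) => [|t IHt] tm; first by rewrite big_ord0 expr0 mul1r subrr.
  rewrite big_ord_recr /= {}IHt; last by move: tm; rewrite doubleS => /ltnW/ltnW.
  rewrite walk_row; last by move: tm; rewrite doubleS => /ltnW.
  by rewrite doubleS exprS mulN1r mulNr opprK mulrDr [_ * E x _ w + _]addrC addrA subrK.
have yx : f (prev c x) = x by rewrite /f next_prev.
have yadj : adj G (prev c x) x by have := adj_next (prev c x); rewrite yx.
have m2 : m./2 = T.+1 by rewrite mT /= doubleK.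
have xN : f x != prev c x.
  by rewrite -[X in f X]yx; apply: next_next_neq.
have q0 j : (forall t, (t < T)%N -> iter t.*2.+2 f x != j) -> q j = 0.
  move=> jN; rewrite /q big1 // => t _.
  by rewrite eq_sym (negPf (jN t (ltn_ord t))) mulr0n.
have Tm t : (t < T)%N -> (t.*2.+2 < T.*2.+1)%N.
  by rewrite -leq_double doubleS ltnS.
have w1 : walk_gain x 1 = gain G x (f x) by rewrite walk_gainS /walk_gain big_ord0 mul1r.
(* At [next c x] the sum agrees with row [x], so [k] is the discrepancy at [prev c x]; multiplying
   by the gain from [prev c x] to [x] closes the walk. *)
exists q, (gain G x (prev c x) - (-1) ^+ m./2 * walk_gain x m.-1); split.
- move=> w; rewrite qE m2 exprS !mulN1r !mulNr opprK mulrnDl mT /= /E -y_iter -mulrnAr.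
  rewrite addrA [X in _ = X]addrAC subrK w1 mxE adjE.
  have -> : (x == f w) = (w == prev c x) by rewrite -{1}yx (inj_eq f_inj) eq_sym.
  have [->|_] := eqVneq w (f x); first by rewrite orTb (negPf xN) mulr1n mulr0n addr0.
  by rewrite mulr0n add0r orFb; case: eqP => [->|_].
- by apply: q0 => t /Tm tT; rewrite -[X in _ != X]/(iter 0 f x) iter_eq ?mT // ltnW // ltnS.
- apply: q0 => t /Tm tT; rewrite -[X in _ != X]/(iter 1 f x).
  by rewrite iter_eq ?mT //; rewrite ltnW // ltnS.
- apply: q0 => t /Tm tT; rewrite y_iter iter_eq ?mT //; last by rewrite ltnW // ltnS.
  by rewrite neq_ltn tT.
have PE : walk_gain x m = walk_gain x m.-1 * gain G (prev c x) x.
  by rewrite -[in LHS](ltn_predK m3) walk_gainS -prev_iter iterS -prev_iter yx.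
have gg : gain G x (prev c x) * gain G (prev c x) x = 1 by rewrite gain_mulC // adj_sym.
have gg' : gain G (prev c x) x * gain G x (prev c x) = 1 by rewrite gain_mulC.
have ee : (-1) ^+ m./2 * (-1) ^+ m./2 = 1 :> quat R.
  by rewrite -exprD addnn -mul2n exprM sqrrN expr1n expr1n.
split.
  move=> /eqP; rewrite subr_eq0 => /eqP ge.
  have : (-1) ^+ m./2 * walk_gain x m = 1 by rewrite PE mulrA -ge.
  by move=> /(congr1 (fun z => (-1) ^+ m./2 * z)); rewrite mulrA ee mul1r mulr1.
rewrite PE => /(congr1 (fun z => z * gain G x (prev c x))).
by rewrite -mulrA gg' mulr1 => ->; rewrite mulrA ee mul1r subrr.
Qed.

Lemma walk_gain_head h s : c = h :: s -> walk_gain h m = cycle_gain G c.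
Proof.
move=> cE; have ct : c = traject f h m.
  have us := uc; rewrite cE in us; have := traject_next us (f := f).
  rewrite -cE => /(_ (frefl _)); rewrite (_ : (size s).+2 = m.+1); last by rewrite /m cE.
  by rewrite trajectSr => /rcons_inj[].
rewrite /cycle_gain [X in \prod_(u <- X) _]ct (big_nth h) size_traject big_mkord.
by apply: eq_bigr => i _; rewrite nth_traject.
Qed.

(** Moving the starting vertex conjugates the gain of the closed walk, and a sign is central. *)
Lemma walk_gain_next z k : walk_gain z m = (-1) ^+ k -> walk_gain (f z) m = (-1) ^+ k.
Proof.
have mE : m = m.-1.+1 by rewrite (ltn_predK m3).
have -> : walk_gain z m = gain G z (f z) * walk_gain (f z) m.-1.
  rewrite {1}mE /walk_gain big_ord_recl; congr (_ * _); apply: eq_bigr => i _.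
  by rewrite -!iterSr.
have -> : walk_gain (f z) m = walk_gain (f z) m.-1 * gain G z (f z).
  rewrite {1}mE walk_gainS; congr (_ * gain G _ _); last by rewrite -mE iter_size.
  by rewrite -iterSr -mE iter_size.
set g := gain G z (f z); set w := walk_gain _ _ => gw.
have ug : g \is a GRing.unit by apply/quat_unit/gain_neq0/adj_next.
by rewrite -[w](mulKr ug) gw -mulrA -(commr_sign g) mulKr.
Qed.

Lemma walk_gain_type1 x : type1 G c -> walk_gain x m = (-1) ^+ m./2.
Proof.
case=> _ gc; have [h hm] : exists h, walk_gain h m = (-1) ^+ m./2.
  have [h [s cE]] : exists h s, c = h :: s.
    by move: m3; rewrite /m; case: (c) => // h s; exists h, s.
  by exists h; rewrite (walk_gain_head cE).
have [_ [k ck]] := rot_traject_next uc (memc h).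
have : x \in traject f h m by rewrite -ck mem_rot.
by move=> /trajectP[i _ ->]; elim: i => [//|i IHi]; exact: walk_gain_next.
Qed.

End GainCycles.

(** * Rank of extremal gain graphs *)

Lemma prev_head_rcons (T : eqType) (x y : T) s : uniq (x :: rcons s y) ->
  prev (x :: rcons s y) x = y.
Proof.
move=> /andP[xs _]; rewrite prev_nth mem_head memNindex //.
by rewrite -[RHS](last_rcons x s y) -[RHS](nth_last x (x :: rcons s y)).
Qed.

Section RankCharacterization.
Variables (R : realType) (n : nat) (G : gain_graph R n).
Let A := adjacency G.

(** Induction removing two vertices at a time: the first vertex is pendant at the second. *)
Lemma induced_path_nonsing p : induced_path G p -> ~~ odd (size p) ->
  nonsing A [set z in p].
Proof.
move: {2}(size p) (leqnn (size p)) => k.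
elim: k p => [|k IHk] [|x [|y p]] //=; rewrite ?negbK;
  try by move=> *; move=> q _ i; rewrite inE.
rewrite ltnS => /ltnW sp /and3P[xyp /andP[/eqP xy xp] /and3P[yp _ ip]] ep.
have -> : [set z in [:: x, y & p]] = x |: (y |: [set z in p]).
  by apply/setP => z; rewrite !inE.
move: xyp; rewrite inE negb_or => /andP[x_y xNp].
apply: nonsing_pendant; rewrite ?inE ?xy //; first exact: IHk.
move=> h; rewrite inE => hp; rewrite (eqP (allP xp h hp)).
by apply: contraNneq yp => <-.
Qed.

Lemma card_seq_set (p : seq 'I_n) : uniq p -> #|[set z in p]| = size p.
Proof. by move=> up; rewrite cardsE; apply/card_uniqP. Qed.

Lemma cycle_gain4 (u1 u2 u3 u4 : 'I_n) : uniq [:: u1; u2; u3; u4] ->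
  cycle_gain G [:: u1; u2; u3; u4] =
  gain G u1 u2 * gain G u2 u3 * gain G u3 u4 * gain G u4 u1.
Proof.
rewrite /= !inE !negb_or => /and4P[/and3P[n12 n13 n14] /andP[n23 n24] n34 _].
rewrite /cycle_gain !big_cons big_nil mulr1 /= !eqxx.
rewrite ![_ == u1]eq_sym (negPf n12) (negPf n13) (negPf n14).
by rewrite ![_ == u2]eq_sym (negPf n23) (negPf n24) [_ == u3]eq_sym (negPf n34) !mulrA.
Qed.

Lemma complete_bipartite_order : is_complete_bipartite G n./2 n./2 ->
  n = (max_degree G).*2.
Proof.
case=> X [cX cXC adjE]; have nE : n = n./2.*2.
  by have := cardsC X; rewrite cX cXC card_ord addnn.
have deg v : degree G v = n./2.
  case: (boolP (v \in X)) => vX.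
    by rewrite -[RHS]cXC; apply: eq_card => j; rewrite !inE adjE vX.
  by rewrite -[RHS]cX; apply: eq_card => j; rewrite !inE adjE (negPf vX); case: (_ \in _).
case: (posnP n) => [n0|n0].
  suff -> : max_degree G = 0%N by rewrite [LHS]n0.
  by rewrite /max_degree big1 // => i; have := ltn_ord i; rewrite {2}n0.
have -> // : max_degree G = n./2.
apply/eqP; rewrite eqn_leq -{2}(deg (Ordinal n0)) degree_le_max andbT.
by apply/bigmax_leqP => v _; rewrite deg.
Qed.

(** Rows of vertices on the same side are left multiples of each other, so one row from each side
    suffices. *)
Lemma type1_bipartite_rank : (0 < n)%N ->
  is_complete_bipartite G n./2 n./2 ->
  (forall c : seq 'I_n, is_cycle_in G c -> size c = 4%N -> type1 G c) ->
  gain_rank G = 2.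
Proof.
move=> n0 bip t1; have nE := complete_bipartite_order bip.
case: bip => X [cX cXC adjE].
have n2 : (0 < n./2)%N by rewrite nE doubleK -double_gt0 -nE.
have [a aX] : exists a, a \in X by apply/card_gt0P; rewrite cX.
have [b bX] : exists b, b \in ~: X by apply/card_gt0P; rewrite cXC.
rewrite inE in bX; have ab : adj G a b by rewrite adjE aX (negPf bX).
have ab0 : a != b by apply: contraNneq bX => <-.
(* Type 1 of the 4-cycle [v], [w], [a'], [b'] is this relation at [w]; when [v = a'] or [w = b'] the
   gains simply cancel. *)
have row v a' b' w : (v \in X) = (a' \in X) -> adj G a' b' ->
    A v w = gain G v b' * gain G b' a' * A a' w.
  move=> va' ab'; have vb' : adj G v b' by rewrite adjE va' -adjE.
  have vw : adj G v w = adj G a' w by rewrite !adjE va'.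
  rewrite !mxE vw; case: ifP => aw; last by rewrite mulr0.
  have [<-|va0] := eqVneq v a'; first by rewrite gain_mulC // mul1r.
  have [<-|wb0] := eqVneq w b'; first by rewrite -mulrA gain_mulC 1?adj_sym // mulr1.
  have neq i j : adj G i j -> i != j by apply: contraTneq => ->; rewrite adj_irr.
  have uc : uniq [:: v; w; a'; b'].
    rewrite /= !inE !negb_or va0 (neq v w) ?vw // (neq v b') // [w == a']eq_sym.
    by rewrite (neq a' w) // wb0 (neq a' b').
  have [] := t1 [:: v; w; a'; b'] _ erefl.
    by split; rewrite //= vw aw [adj G w a']adj_sym aw ab' adj_sym vb'.
  move=> _; rewrite cycle_gain4 // sqrrN expr1n => g1.
  have := congr1 (fun z => z * (gain G v b' * gain G b' a' * gain G a' w)) g1.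
  rewrite mul1r => <-; rewrite !mulrA.
  rewrite -(mulrA _ (gain G b' v)) gain_mulC 1?adj_sym // mulr1.
  rewrite -(mulrA _ (gain G a' b')) gain_mulC // mulr1.
  by rewrite -mulrA gain_mulC 1?adj_sym // mulr1.
rewrite -[2]/(size [:: a; b]) -(@card_seq_set [:: a; b]); last by rewrite /= inE ab0.
apply: (nonsing_rank (A := A)).
  by apply: induced_path_nonsing; rewrite //= inE ab0 ab eqxx.
have sumE (q : 'I_n -> quat R) w :
    \sum_(i in [set z in [:: a; b]]) q i * A i w = q a * A a w + q b * A b w.
  rewrite (big_setD1 a) ?inE ?eqxx //=.
  rewrite (big_setD1 b) ?inE ?eqxx ?orbT //= 1?eq_sym ?ab0 //.
  rewrite big1 ?addr0 // => i; rewrite !inE => /and3P[/negPf -> /negPf ->] //.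
move=> v; have [vX|vX] := boolP (v \in X).
  exists (fun i => if i == a then gain G v b * gain G b a else 0) => w.
  rewrite sumE eqxx [b == a]eq_sym (negPf ab0) mul0r addr0.
  by apply: row; rewrite ?aX ?vX.
exists (fun i => if i == b then gain G v a * gain G a b else 0) => w.
rewrite sumE eqxx (negPf ab0) mul0r add0r.
by apply: row; rewrite ?(negPf bX) ?(negPf vX) // adj_sym.
Qed.

Lemma type1_cycle_rank c : is_cycle_graph G c -> type1 G c ->
  (gain_rank G + 2 = n)%N.
Proof.
move=> cG tc; have [[m3 uc _] memc _] := cG.
have nE := cycle_graph_order cG; have ec : ~~ odd (size c) by case: tc.
have [x _] : exists x : 'I_n, true by case: (c) m3 => // i; exists i.
(* All vertices but [x] and [prev c x], read along the cycle. *)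
pose p := traject (next c) (next c x) (size c - 2).
have ipp : induced_path G p.
  by apply: cycle_graph_induced_path => //; rewrite ltn_subrL; case: size m3.
have ep : ~~ odd (size p) by rewrite size_traject oddB ?(ltnW m3) // addbF.
have outP i : i \notin [set z in p] -> i = x \/ i = prev c x.
  have [ix [k ck]] := rot_traject_next uc (memc x).
  have : i \in traject (next c) x (size c) by rewrite -ck mem_rot.
  have -> : size c = (size c - 2).+2 by case: size m3 => [|[|[|k']]] // _; rewrite subn2.
  rewrite trajectS trajectSr in_cons mem_rcons in_cons in_set -/p.
  move=> /or3P[/eqP->|/eqP->|->] // _.
    by left.
  right; rewrite (prev_iter cG) -iterSr.
  have -> // : (size c - 2).+1 = (size c).-1.
  by case: size m3 => [|[|[|k']]] // _; rewrite subn2.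
suff -> : gain_rank G = size p by rewrite size_traject subnK ?(ltnW m3).
rewrite -(card_seq_set (induced_path_uniq ipp)); apply: (nonsing_rank (A := A)).
  exact: induced_path_nonsing.
apply: spanning_outside => v vS.
(* The coefficients vanish at [v] and at both its neighbours; as [x] and [prev c x] are adjacent,
   [q] is supported on [p] whichever of them [v] is. *)
have [q [k [AE qv qn qp kE]]] := cycle_row_relation cG v ec.
exists q => w; rewrite AE kE.2 ?mul0rn ?addr0; last exact: walk_gain_type1.
rewrite [RHS]big_mkcond; apply: eq_bigr => i _; case: ifPn => // /outP iv.
suff -> : q i = 0 by rewrite mul0r.
have yx : next c (prev c x) = x by rewrite next_prev.
by case: iv (outP v vS) => [] -> [] vE; move: qv qn qp; rewrite vE ?yx.
Qed.

(** * The structure forced by equality *)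

Section Extremal.
Hypotheses (G_conn : connected_graph G) (Delta_ge2 : (2 <= max_degree G)%N).
Hypothesis rank_eq : (gain_rank G * max_degree G + 2 = n + gain_rank G)%N.

Lemma induced_path_set0 x p : [set z in x :: p] != set0 :> {set 'I_n}.
Proof. by apply/set0Pn; exists x; rewrite inE mem_head. Qed.

(** An edge at [v] is an even induced path, to which [tight_degree] applies; without one, [v] would
    be the whole graph. *)
Lemma extremal_regular v : degree G v = max_degree G.
Proof.
have [w vw] : exists w, adj G v w.
  apply: contrapT => vN; have all_v z : z \in [set v].
    apply: (connected_closed (x := v) G_conn); first by rewrite inE.
    by move=> y w; rewrite !inE => /eqP -> vw; case: vN; exists w.
  have : (max_degree G <= 0)%N; last by rewrite leqNgt (ltnW Delta_ge2).
  apply/bigmax_leqP => i _; rewrite leqn0 cards_eq0; apply/eqP/setP => j.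
  have := all_v i; have := all_v j; rewrite !inE => /eqP -> /eqP ->.
  by rewrite adj_irr.
have ip : induced_path G [:: v; w].
  by rewrite /= inE vw eqxx !andbT; apply: contraTneq vw => ->; rewrite adj_irr.
apply: (tight_degree G_conn rank_eq (H := [set z in [:: v; w]])).
- exact: induced_path_nonsing ip isT.
- exact: induced_path_set0.
- exact: induced_path_sparse.
- by rewrite inE mem_head.
Qed.

Lemma extremal_path_neighbor p w h1 h2 : induced_path G p -> ~~ odd (size p) ->
  w \notin p -> h1 \in p -> h2 \in p -> adj G w h1 -> adj G w h2 -> h1 = h2.
Proof.
case: p => [//|x p] ip ep wp h1p h2p.
apply: (tight_unique_neighbor G_conn rank_eq (H := [set z in x :: p])).
- exact: induced_path_nonsing.
- exact: induced_path_set0.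
- exact: induced_path_sparse.
- by rewrite inE.
- by rewrite inE.
- by rewrite inE.
Qed.

Lemma extremal_path_spanning x p : induced_path G (x :: p) ->
  ~~ odd (size (x :: p)) -> size (x :: p) = gain_rank G ->
  spanning A [set z in x :: p].
Proof.
move=> ip ep sp; apply: (tight_spanning G_conn rank_eq).
- exact: induced_path_nonsing.
- exact: induced_path_set0.
- by rewrite card_seq_set ?induced_path_uniq ?(induced_path_uniq ip).
Qed.

(** Row [x] is a combination of the rows of the path and also satisfies the cycle relation. The
    difference is supported at [y], so nonsingularity of the path equates the coefficients and
    leaves [k = 0]. *)
Lemma extremal_cycle_type1 x y a p : is_cycle_graph G (x :: rcons (a :: p) y) ->
  induced_path G (a :: p) -> ~~ odd (size (a :: p)) ->
  type1 G (x :: rcons (a :: p) y).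
Proof.
set P := a :: p; set c := x :: rcons P y => cG ip ep.
have [[m3 uc _] memc _] := cG.
have sc : size c = (size P).+2 by rewrite /= size_rcons.
have ec : ~~ odd (size c) by rewrite sc /= negbK.
have D2 := cycle_graph_max_degree cG; have nE := cycle_graph_order cG.
have rP : size P = gain_rank G.
  by move: rank_eq nE; rewrite D2 sc; move: (gain_rank G) => r; lia.
have spP := extremal_path_spanning ip ep rP.
have nsP := induced_path_nonsing ip ep.
have [q [k [AE qx _ qy kE]]] := cycle_row_relation cG x ec.
have yE : prev c x = y := prev_head_rcons uc.
have [q' AE'] := spP x.
have q0 i : i \notin P -> q i = 0.
  have := memc i; rewrite inE mem_rcons inE => /or3P[/eqP->|/eqP->|->] // _.
  by rewrite -yE.
have sumq w : \sum_i q i * A i w = \sum_(i in [set z in P]) q i * A i w.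
  rewrite [RHS]big_mkcond; apply: eq_bigr => i _; case: ifPn => //.
  by rewrite inE => /q0 ->; rewrite mul0r.
have yP : y \notin P.
  by move: uc; rewrite /c cons_uniq rcons_uniq => /and3P[].
have dE w : \sum_(i in [set z in P]) (q' i - q i) * A i w = k *+ (w == y).
  under eq_bigr do rewrite mulrBl.
  by rewrite sumrB -AE' -sumq AE yE addrAC subrr add0r.
have qq i : i \in [set z in P] -> q' i - q i = 0.
  apply: (nsP (fun i => q' i - q i)) => w; rewrite inE => wP; rewrite dE.
  by case: eqP yP => [<-|//]; rewrite wP.
have k0 : k = 0.
  have := dE y; rewrite eqxx mulr1n => <-.
  by rewrite big1 // => i /qq ->; rewrite mul0r.
split=> //; rewrite -(walk_gain_head cG (h := x) (s := rcons P y)) //.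
exact/kE.
Qed.

Lemma extremal_bipartite_type1 c : is_complete_bipartite G n./2 n./2 ->
  is_cycle_in G c -> size c = 4%N -> type1 G c.
Proof.
move=> bip [_ uc cc] sc; have nE := complete_bipartite_order bip.
have r2 : gain_rank G = 2.
  (* With n = 2D, the rank equation reads (r - 2)(D - 1) = 0. *)
  move: rank_eq nE Delta_ge2; move: (gain_rank G) (max_degree G) => r D.
  by move=> re nE D2; nia.
case: bip => X [_ _ adjE].
case: c uc cc sc => [|u1 [|u2 [|u3 [|u4 [|]]]]] // uc.
rewrite /= andbT => /and4P[e12 e23 e34 e41] _; split=> //.
rewrite cycle_gain4 // sqrrN expr1n.
have ip : induced_path G [:: u1; u2].
  by rewrite /= inE e12 eqxx !andbT; apply: contraTneq e12 => ->; rewrite adj_irr.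
have [q AE] := extremal_path_spanning ip isT (esym r2) u3.
have u12 : u1 != u2 by apply: contraTneq e12 => ->; rewrite adj_irr.
have sumE w : A u3 w = q u1 * A u1 w + q u2 * A u2 w.
  rewrite AE (big_setD1 u1) ?inE ?eqxx //=.
  rewrite (big_setD1 u2) ?inE ?eqxx ?orbT //= 1?eq_sym ?u12 //.
  by rewrite big1 ?addr0 // => i; rewrite !inE => /and3P[/negPf -> /negPf ->].
have e31 : adj G u3 u1 = false.
  by move: e12 e23; rewrite !adjE; case: (u1 \in X); case: (u2 \in X); case: (u3 \in X).
have e24 : adj G u2 u4 = false.
  by move: e23 e34; rewrite !adjE; case: (u2 \in X); case: (u3 \in X); case: (u4 \in X).
(* Column [u1] removes row [u2]; row [u3] is then a multiple of row [u1], and comparing columns [u2]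
   and [u4] gives the gain of the cycle. *)
have q2 : q u2 = 0.
  have := sumE u1; rewrite !mxE e31 adj_irr mulr0 add0r [adj G u2 u1]adj_sym e12 => q2.
  by apply: mulq_eq0 (esym q2) _; apply: gain_neq0; rewrite adj_sym.
have := sumE u2; rewrite !mxE [adj G u3 u2]adj_sym e23 e12 q2 mul0r addr0 => g32.
have := sumE u4; rewrite !mxE e34 [adj G u1 u4]adj_sym e41 q2 mul0r addr0 => g34.
have g12 : gain G u1 u2 * gain G u2 u1 = 1 by rewrite gain_mulC.
rewrite g34 -!mulrA gain_mulC 1?adj_sym // mulr1.
have -> : q u1 = gain G u3 u2 * gain G u2 u1 by rewrite g32 -mulrA g12 mulr1.
by rewrite (mulrA (gain G u2 u3)) gain_mulC // mul1r.
Qed.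

Lemma extremal_structure :
  (exists c : seq 'I_n, is_cycle_graph G c /\ type1 G c) \/
  (is_complete_bipartite G n./2 n./2 /\
   forall c : seq 'I_n, is_cycle_in G c -> size c = 4%N -> type1 G c).
Proof.
have n_gt0 : (0 < n)%N.
  case: (posnP n) => // n0; move: Delta_ge2; rewrite leqNgt ltnS.
  case/negP; apply/bigmax_leqP => i; have := ltn_ord i; by rewrite {2}n0.
have Greg := extremal_regular; have Gpath := extremal_path_neighbor.
have [a [b [p lP]]] := exists_longest_even_path Delta_ge2 Greg n_gt0.
case: p lP => [|e p] lP.
  have bip := longest_edge_bipartite G_conn Delta_ge2 Greg Gpath lP.
  by right; split=> // c cG sc; apply: extremal_bipartite_type1.
have D2 := longest_even_path_degree2 Delta_ge2 Greg Gpath lP.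
have [|x [y cG]] := longest_even_path_cycle G_conn Delta_ge2 Greg Gpath _ D2 lP; first by [].
left; exists (x :: rcons [:: a, b, e & p] y); split=> //.
by case: lP => ip ep _; apply: extremal_cycle_type1.
Qed.

End Extremal.
End RankCharacterization.

(** Clears the denominator, so that the counting can be done in [nat] without truncated
    subtraction. *)
Lemma rank_eqP (r n D : nat) : (2 <= D)%N ->
  (r%:R = (n%:R - 2) / (D%:R - 1) :> rat) <-> (r * D + 2 = n + r)%N.
Proof.
move=> D2; have D0 : (D%:R - 1 : rat) != 0.
  by rewrite subr_eq0 pnatr_eq1; case: D D2 => [|[|]].
split=> [rE|rE].
  have : (r%:R * (D%:R - 1) = n%:R - 2 :> rat) by rewrite rE divfK.
  move=> {}rE; apply/eqP; rewrite -(eqr_nat rat) !natrD natrM; apply/eqP.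
  by rewrite -[r%:R * D%:R](subrK r%:R) -{2}[r%:R]mulr1 -mulrBr rE addrAC subrK.
apply: (canRL (mulfK D0)); have : ((r * D + 2)%N%:R = (n + r)%N%:R :> rat) by rewrite rE.
by rewrite !natrD natrM => {}rE; rewrite mulrBr mulr1 -[r%:R * _](addrK 2) rE addrAC addrK.
Qed.

Unset Implicit Arguments.

Theorem theorem4p3 (R : realType) (n : nat) (n_gt0 : (0 < n)%N)
    (G : gain_graph R n)
    (G_conn : connected_graph G) (Delta_ge2 : (2 <= max_degree G)%N) :
  (gain_rank G)%:R = (n%:R - 2) / ((max_degree G)%:R - 1) :> rat
  <->
  (exists c : seq 'I_n, is_cycle_graph G c /\ type1 G c)
  \/
  (is_complete_bipartite G n./2 n./2 /\
   forall c : seq 'I_n, is_cycle_in G c -> size c = 4%N -> type1 G c).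
Proof.
rewrite rank_eqP //; split; first exact: extremal_structure.
case=> [[c [cG tc]]|[bip t1]].
  have := type1_cycle_rank cG tc; rewrite (cycle_graph_max_degree cG); lia.
have := complete_bipartite_order bip; rewrite (type1_bipartite_rank n_gt0 bip t1); lia.
Qed.
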